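(* Let $K$ be a positive integer, let $p\in\mathbb{Z}$ with $p\ne 0$, and set $q=2K(2pK+1)$. Then \[ f\left(\tfrac{1}{2}\sqrt{p/q}\right)=\begin{cases}1/2 & \text{if } p \text{ is even},\\ 1/2-K/q & \text{if } p \text{ is odd},\end{cases} \] where $f(r)=\frac{4}{\pi^2}\sum_{k\ge0}\frac{\sec((2k+1)\pi r)}{(2k+1)^2}$.
   Context: The function $f$ is defined by $f(r)=\frac{4}{\pi^2}\sum_{k\ge0}\frac{\sec((2k+1)\pi r)}{(2k+1)^2}$, with $\sec x=1/\cos x$. Note that $p/q>0$ for all admissible $p,K$ (if $p<0$ then also $q<0$), so $\tfrac12\sqrt{p/q}$ is a positive real number. (For instance $K=1,p=-1$ gives $f(1/\sqrt{8})=1$.) *)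

(* Defs.v *)
From Stdlib Require Import Reals.
From Coquelicot Require Import Coquelicot.
Open Scope R_scope.

Definition f_term (r : R) (k : nat) : R :=
  4 / PI ^ 2 * (/ cos ((2 * INR k + 1) * PI * r) / (2 * INR k + 1) ^ 2).

Definition f_equals (r v : R) : Prop := is_series (f_term r) v.

(* Main.v *)
Require Import Defs.
From Stdlib Require Import Reals ZArith Lra Lia List.
From Coquelicot Require Import Coquelicot.
Open Scope R_scope.

(** Put [th = 2 r]. Expanding the secant into partial fractions and exchanging
    the order of summation in
    [sum_n sum_m (-1)^((m-1)/2) / (m (m^2 - th^2 n^2))] ([m], [n] odd) gives the
    reciprocity [f (th / 2) = 1/2 - (4 th / PI^2) T (1 / (2 th))], where
    [T x = sum_m (-1)^((m-1)/2) tan (PI m x) / m^2] has period 1. The exchange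
    is legitimate for badly approximable [th]: the distances of the numbers
    [th n], [n <= X], to the odd integers are separated by [c / X], which makes
    the secant series absolutely convergent.
    For [th = sqrt (p / q)] the numbers [th1 = th / (1 + 2 K th)] and
    [th2 = th / (1 - 2 K th)] have the same value of [T] as [th], and
    [th2 - th1 = 2 p], so that [f (th2 / 2) = (-1)^p f (th1 / 2)]. This is a
    linear equation for [T], hence determines [f (th / 2)]. *)

(** * Odd integers, elementary sine estimates and the Leibniz series *)

Definition odd (k : nat) : R := 2 * INR k + 1.

Lemma odd_ge1 (k : nat) : 1 <= odd k.
Proof. unfold odd; pose proof (pos_INR k); lra. Qed.

Lemma odd_S (k : nat) : odd (S k) = odd k + 2.
Proof. unfold odd; rewrite S_INR; lra. Qed.

Lemma sum_n_S (a : nat -> R) (n : nat) : sum_n a (S n) = sum_n a n + a (S n).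
Proof. exact (sum_Sn a n). Qed.

Lemma sum_n_0 (a : nat -> R) : sum_n a 0 = a 0%nat.
Proof. exact (sum_O a). Qed.

Lemma sin_lower (t : R) : 0 <= t <= PI / 2 -> t / 3 <= sin t.
Proof.
intros [H0 H1]; pose proof PI_4 as HP.
(* For [t <= 2] the cubic Taylor bound [t - t^3 / 6] is at least [t / 3]. *)
assert (Ht2 : t <= 2) by lra.
destruct (sin_bound t 0 H0 ltac:(lra)) as [H _].
assert (E : sin_approx t (2 * 0 + 1) = t - t * (t * t) / 6).
{ unfold sin_approx, sin_term; simpl; field. }
rewrite E in H; nra.
Qed.

Lemma sin_abs_le (x : R) : Rabs (sin x) <= Rabs x.
Proof.
assert (H : forall y, 0 <= y -> Rabs (sin y) <= y).
{ intros y Hy.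
  destruct (Rle_dec y 1) as [H1|H1].
  - rewrite Rabs_pos_eq.
    + destruct Hy as [Hy|<-]; [left; exact (sin_lt_x y Hy)|rewrite sin_0; lra].
    + apply sin_ge_0; [lra|]. pose proof PI2_1; lra.
  - apply Rabs_le; pose proof (SIN_bound y); lra. }
destruct (Rle_dec 0 x) as [Hx|Hx].
- rewrite (Rabs_pos_eq x) by lra; apply H; lra.
- rewrite <- (Rabs_Ropp (sin x)), <- sin_neg, (Rabs_left x) by lra; apply H; lra.
Qed.

(** The product-to-sum formula makes the sum telescope. The oscillation of the right-hand side in
    [N] is what drives the convergence below. *)
Lemma dirichlet_kernel (t : R) (N : nat) :
  2 * sin t * sum_n (fun k => cos (odd k * t)) N = sin ((odd N + 1) * t).
Proof.
induction N as [|N IH].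
- rewrite sum_n_0; unfold odd; simpl.
  replace ((2 * 0 + 1) * t) with t by ring.
  replace ((2 * 0 + 1 + 1) * t) with (2 * t) by ring.
  now rewrite sin_2a.
- rewrite sum_n_S, Rmult_plus_distr_l, IH, odd_S.
  replace ((odd N + 1) * t) with ((odd N + 2) * t - t) by ring.
  replace ((odd N + 2 + 1) * t) with ((odd N + 2) * t + t) by ring.
  rewrite sin_minus, sin_plus; ring.
Qed.

Lemma sin_odd_half_PI (k : nat) : sin (odd k * (PI / 2)) = (-1) ^ k.
Proof.
induction k as [|k IH].
- unfold odd; simpl; replace ((2 * 0 + 1) * (PI / 2)) with (PI / 2) by ring.
  apply sin_PI2.
- rewrite odd_S; replace ((odd k + 2) * (PI / 2)) with (odd k * (PI / 2) + PI) by field.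
  rewrite neg_sin, IH; simpl; ring.
Qed.

Lemma cos_odd_half_PI (k : nat) : cos (odd k * (PI / 2)) = 0.
Proof.
induction k as [|k IH].
- unfold odd; simpl; replace ((2 * 0 + 1) * (PI / 2)) with (PI / 2) by ring.
  apply cos_PI2.
- rewrite odd_S; replace ((odd k + 2) * (PI / 2)) with (odd k * (PI / 2) + PI) by field.
  rewrite neg_cos, IH; ring.
Qed.

Lemma leibniz_series : is_series (fun k => (-1) ^ k / odd k) (PI / 4).
Proof.
(* [exist_PI] provides the limit of the alternating series, and [Alt_PI_eq] identifies it with a
   quarter of [PI]. *)
assert (E : PI / 4 = let (a, _) := exist_PI in a).
{ rewrite <- Alt_PI_eq; unfold Alt_PI; field. }
rewrite E; destruct exist_PI as [a Ha].
apply is_lim_seq_Reals in Ha.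
apply (is_lim_seq_ext _ (sum_n (fun k => (-1) ^ k / odd k))) in Ha; [exact Ha|].
intros n; rewrite <- sum_n_Reals.
apply sum_n_ext; intros k; unfold tg_alt, PI_tg, odd.
rewrite plus_INR, mult_INR; simpl; unfold Rdiv; f_equal.
Qed.

(** * Fourier series of smooth functions at the origin *)

Section KernelLimit.
Variables (g g1 g2 : R -> R) (A : nat -> R -> R) (C : R).
Hypothesis g_derive : forall t, is_derive g t (g1 t).
Hypothesis g1_derive : forall t, is_derive g1 t (g2 t).
Hypothesis g_bound : forall t, 0 <= t <= PI / 2 ->
  Rabs (g t - g 0) <= C /\ Rabs (g1 t) <= C /\ Rabs (g2 t) <= C.
(** Explicit antiderivatives [A k] stand for the integrals of [g] against odd cosines, so that
    derivatives and the mean value theorem suffice. *)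
Hypothesis A_derive : forall k t, is_derive (A k) t (g t * cos (odd k * t)).

Let C_ge0 : 0 <= C.
Proof.
destruct (g_bound 0) as [H _]; [pose proof PI_RGT_0; lra|].
pose proof (Rabs_pos (g 0 - g 0)); lra.
Qed.

Lemma kernel_difference_bound (t : R) : 0 <= t <= PI / 2 -> Rabs (g t - g 0) <= C * t.
Proof.
intros Ht.
destruct (MVT_gen g 0 t g1) as [c [Hc E]].
- intros x _; apply g_derive.
- intros x _; apply derivable_continuous_pt; exists (g1 x).
  apply is_derive_Reals, g_derive.
- rewrite Rmin_left, Rmax_right in Hc by lra.
  rewrite E, Rminus_0_r, Rabs_mult, (Rabs_pos_eq t) by lra.
  apply Rmult_le_compat_r; [lra|]; apply g_bound; lra.
Qed.

(** This is the numerator of the derivative of [(g t - g 0) / sin t]. In its own derivative the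
    terms with [g1 * cos] cancel and a factor [sin] remains, so it vanishes to second order at 0. *)
Lemma kernel_numerator_bound (t : R) : 0 <= t <= PI / 2 ->
  Rabs (g1 t * sin t - (g t - g 0) * cos t) <= 2 * C * t ^ 2.
Proof.
intros Ht.
set (num := fun x => g1 x * sin x - (g x - g 0) * cos x).
assert (D : forall x, is_derive num x (g2 x * sin x + (g x - g 0) * sin x)).
{ intros x; unfold num; auto_derive.
  - repeat split; [exists (g2 x); apply g1_derive|exists (g1 x); apply g_derive].
  - replace (Derive (fun y => g1 y) x) with (g2 x)
      by (symmetry; apply is_derive_unique, g1_derive).
    replace (Derive (fun y => g y) x) with (g1 x)
      by (symmetry; apply is_derive_unique, g_derive).
    ring. }
destruct (MVT_gen num 0 t (fun x => g2 x * sin x + (g x - g 0) * sin x)) as [c [Hc E]].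
- intros x _; apply D.
- intros x _; apply derivable_continuous_pt.
  exists (g2 x * sin x + (g x - g 0) * sin x); apply is_derive_Reals, D.
- rewrite Rmin_left, Rmax_right in Hc by lra.
  assert (N0 : num 0 = 0) by (unfold num; rewrite sin_0; ring).
  rewrite N0, !Rminus_0_r in E; fold (num t); rewrite E.
  rewrite <- Rmult_plus_distr_r, !Rabs_mult, (Rabs_pos_eq t) by lra.
  destruct (g_bound c) as [B0 [_ B2]]; [lra|].
  pose proof (Rabs_triang (g2 c) (g c - g 0)).
  pose proof (sin_abs_le c) as Hs; rewrite (Rabs_pos_eq c) in Hs by lra.
  replace (2 * C * t ^ 2) with (2 * C * t * t) by ring.
  apply Rmult_le_compat_r; [lra|].
  apply Rmult_le_compat; try apply Rabs_pos; lra.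
Qed.

(** Subtracting the antiderivatives belonging to the constant [g 0] produces the factor [g t - g 0],
    which compensates the zero of [sin t] in the denominator of the Dirichlet kernel. *)
Let U (N : nat) (t : R) : R :=
  sum_n (fun k => A k t - g 0 * (sin (odd k * t) / odd k)) N.

Let U_derive (N : nat) (t : R) :
  is_derive (U N) t ((g t - g 0) * sum_n (fun k => cos (odd k * t)) N).
Proof.
replace ((g t - g 0) * sum_n (fun k => cos (odd k * t)) N)
  with (sum_n (fun k => (g t - g 0) * cos (odd k * t)) N)
  by exact (sum_n_mult_l (K := R_Ring) (g t - g 0) (fun k => cos (odd k * t)) N).
apply (is_derive_sum_n (V := R_NormedModule)); intros k _.
pose proof (odd_ge1 k).
auto_derive.
- repeat split; eexists; apply A_derive.
- replace (Derive (fun x => A k x) t) with (g t * cos (odd k * t))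
    by (symmetry; apply is_derive_unique, A_derive).
  field; lra.
Qed.

(* Integration by parts against [sin ((odd N + 1) t)], written with explicit
   antiderivatives; [(g t - g 0) / sin t] extends to a C^1 function at 0. *)
Lemma kernel_oscillation (N : nat) (e : R) : 0 < e <= PI / 2 ->
  Rabs (U N (PI / 2) - U N e) <= 21 * C / (odd N + 1).
Proof.
intros He; pose proof (odd_ge1 N) as HN; pose proof PI_4 as HP.
set (w := odd N + 1).
set (h := fun t => (g t - g 0) / sin t).
set (V := fun t => U N t + h t * cos (w * t) / (2 * w)).
set (dh := fun t => (g1 t * sin t - (g t - g 0) * cos t) / (sin t) ^ 2).
assert (Spos : forall t, 0 < t <= PI / 2 -> 0 < sin t).
{ intros t Ht; pose proof (sin_lower t ltac:(lra)); lra. }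
assert (DV : forall t, 0 < t <= PI / 2 -> is_derive V t (dh t * cos (w * t) / (2 * w))).
{ intros t Ht; pose proof (Spos t Ht); unfold V, h, dh.
  auto_derive.
  - repeat split; try lra; eexists; [apply U_derive|apply g_derive].
  - replace (Derive (fun x => U N x) t)
      with ((g t - g 0) * sum_n (fun k => cos (odd k * t)) N)
      by (symmetry; apply is_derive_unique, U_derive).
    replace (Derive (fun x => g x) t) with (g1 t)
      by (symmetry; apply is_derive_unique, g_derive).
    replace (sum_n (fun k => cos (odd k * t)) N) with (sin (w * t) / (2 * sin t)).
    + field; unfold w; lra.
    + unfold w; rewrite <- dirichlet_kernel; field; lra. }
assert (Hh : forall t, 0 < t <= PI / 2 -> Rabs (h t * cos (w * t) / (2 * w)) <= 3 * C / (2 * w)).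
{ intros t Ht; pose proof (Spos t Ht) as Hs; pose proof (sin_lower t ltac:(lra)).
  assert (B : Rabs (h t) <= 3 * C).
  { unfold h, Rdiv; rewrite Rabs_mult, Rabs_inv, (Rabs_pos_eq (sin t)) by lra.
    apply (Rmult_le_reg_r (sin t)); [lra|].
    rewrite Rmult_assoc, Rinv_l, Rmult_1_r by lra.
    pose proof (kernel_difference_bound t ltac:(lra)).
    pose proof (Rmult_le_compat_l C (t / 3) (sin t) C_ge0 ltac:(lra)); lra. }
  unfold Rdiv; rewrite Rabs_mult, (Rabs_pos_eq (/ (2 * w)))
    by (left; apply Rinv_0_lt_compat; unfold w; lra).
  apply Rmult_le_compat_r; [left; apply Rinv_0_lt_compat; unfold w; lra|].
  rewrite Rabs_mult; pose proof (COS_bound (w * t)) as Hc.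
  assert (Rabs (cos (w * t)) <= 1) by (apply Rabs_le; lra).
  pose proof (Rabs_pos (h t)); pose proof (Rabs_pos (cos (w * t))); nra. }
assert (Hdh : forall t, 0 < t <= PI / 2 -> Rabs (dh t * cos (w * t) / (2 * w)) <= 9 * C / w).
{ intros t Ht; pose proof (Spos t Ht) as Hs; pose proof (sin_lower t ltac:(lra)).
  assert (B : Rabs (dh t) <= 18 * C).
  { unfold dh, Rdiv; rewrite Rabs_mult, Rabs_inv, (Rabs_pos_eq (sin t ^ 2)) by nra.
    apply (Rmult_le_reg_r (sin t ^ 2)); [nra|].
    rewrite Rmult_assoc, Rinv_l, Rmult_1_r by nra.
    pose proof (kernel_numerator_bound t ltac:(lra)).
    assert (t ^ 2 <= 9 * sin t ^ 2) by nra.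
    pose proof (Rmult_le_compat_l C (t ^ 2) (9 * sin t ^ 2) C_ge0 ltac:(lra)); lra. }
  replace (9 * C / w) with (18 * C / (2 * w)) by (field; unfold w; lra).
  unfold Rdiv; rewrite Rabs_mult, (Rabs_pos_eq (/ (2 * w)))
    by (left; apply Rinv_0_lt_compat; unfold w; lra).
  apply Rmult_le_compat_r; [left; apply Rinv_0_lt_compat; unfold w; lra|].
  rewrite Rabs_mult; pose proof (COS_bound (w * t)) as Hc.
  assert (Rabs (cos (w * t)) <= 1) by (apply Rabs_le; lra).
  pose proof (Rabs_pos (dh t)); pose proof (Rabs_pos (cos (w * t))); nra. }
assert (HV : Rabs (V (PI / 2) - V e) <= 18 * C / w).
{ destruct (MVT_gen V e (PI / 2) (fun t => dh t * cos (w * t) / (2 * w))) as [c [Hc E]];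
    rewrite ?Rmin_left, ?Rmax_right in * by lra.
  - intros x Hx; apply DV; lra.
  - intros x Hx; apply derivable_continuous_pt.
    exists (dh x * cos (w * x) / (2 * w)); apply is_derive_Reals, DV; lra.
  - rewrite E, Rabs_mult, (Rabs_pos_eq (PI / 2 - e)) by lra.
    pose proof (Hdh c ltac:(lra)).
    pose proof (Rabs_pos (dh c * cos (w * c) / (2 * w))).
    replace (18 * C / w) with (9 * C / w * 2) by (field; unfold w; lra).
    apply Rmult_le_compat; lra. }
pose proof (Hh e He) as H1; pose proof (Hh (PI / 2) ltac:(lra)) as H2.
unfold V in HV.
(* The interval has length at most 2 and the derivative of [V] is at most [9 * C / w]; each of the
   two boundary terms adds [3 * C / (2 * w)]. *)
replace (21 * C / w) with (18 * C / w + 3 * C / (2 * w) + 3 * C / (2 * w))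
  by (field; unfold w; lra).
revert H1 H2 HV; unfold Rabs; repeat destruct Rcase_abs; lra.
Qed.

(** The increments of [U N] tend to 0, so only the subtracted constant part survives, and it is
    [g 0] times the Leibniz series. *)
Lemma kernel_series : is_series (fun k => A k (PI / 2) - A k 0) (PI / 4 * g 0).
Proof.
pose proof PI_RGT_0 as HP.
assert (HU : forall N, Rabs (U N (PI / 2) - U N 0) <= 21 * C / (odd N + 1)).
(* The oscillation bound holds from every [e > 0]; exceeding it at 0 by a margin [d] would
   contradict the continuity of [U N]. *)
{ intros N; apply Rnot_lt_le; intros Hlt.
  set (d := Rabs (U N (PI / 2) - U N 0) - 21 * C / (odd N + 1)).
  assert (Hc : continuity_pt (U N) 0).
  { apply derivable_continuous_pt; eexists; apply is_derive_Reals, U_derive. }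
  destruct (Hc d) as [a [Ha Hlim]]; [unfold d; lra|].
  set (e := Rmin (a / 2) (PI / 2)).
  assert (He : 0 < e <= PI / 2).
  { unfold e; split; [apply Rmin_glb_lt; lra|apply Rmin_r]. }
  assert (Hea : e < a) by (unfold e; pose proof (Rmin_l (a / 2) (PI / 2)); lra).
  assert (Hd : Rabs (U N e - U N 0) < d).
  { apply (Hlim e); split; [split; [exact I|lra]|].
    simpl; unfold Rdist; rewrite Rminus_0_r, Rabs_pos_eq; lra. }
  pose proof (kernel_oscillation N e He) as Ho.
  pose proof (Rabs_triang (U N (PI / 2) - U N e) (U N e - U N 0)) as Ht.
  replace (U N (PI / 2) - U N e + (U N e - U N 0)) with (U N (PI / 2) - U N 0) in Ht by ring.
  unfold d in Hd; lra. }
assert (Hlim : is_lim_seq (fun N => U N (PI / 2) - U N 0) 0).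
{ apply is_lim_seq_abs_0.
  apply (is_lim_seq_le_le (fun _ => 0) _ (fun N => 21 * C * / INR (S N))).
  - intros N; split; [apply Rabs_pos|].
    apply (Rle_trans _ _ _ (HU N)); unfold Rdiv.
    apply Rmult_le_compat_l; [pose proof C_ge0; lra|].
    pose proof (pos_INR N); apply Rinv_le_contravar; unfold odd; rewrite S_INR; lra.
  - apply is_lim_seq_const.
  - replace (Finite 0) with (Rbar_mult (21 * C) 0) by (simpl; f_equal; ring).
    apply is_lim_seq_scal_l.
    apply (is_lim_seq_incr_1 (fun n => / INR n)).
    apply (is_lim_seq_inv INR p_infty); [apply is_lim_seq_INR|discriminate]. }
assert (HL : is_lim_seq (sum_n (fun k => g 0 * ((-1) ^ k / odd k))) (g 0 * (PI / 4)))
  by exact (is_series_scal_l (g 0) _ _ leibniz_series).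
change (is_lim_seq (sum_n (fun k => A k (PI / 2) - A k 0)) (PI / 4 * g 0)).
replace (Finite (PI / 4 * g 0)) with (Finite (0 + g 0 * (PI / 4))) by (f_equal; ring).
eapply is_lim_seq_ext; [|exact (is_lim_seq_plus' _ _ _ _ Hlim HL)].
intros N; simpl.
induction N as [|N IH].
- unfold U; rewrite !sum_n_0, sin_odd_half_PI, Rmult_0_r, sin_0.
  unfold odd; simpl; field.
- unfold U in *; rewrite !sum_n_S, <- IH, sin_odd_half_PI, Rmult_0_r, sin_0.
  pose proof (odd_ge1 (S N)); field; lra.
Qed.

End KernelLimit.

(** * Partial fractions of secant and tangent *)

(** The cosine vanishes at odd multiples of [PI / 2] and is 1-Lipschitz. Its size therefore bounds
    the distance from [y] to every odd integer from below. *)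
Lemma cos_half_PI_le (k : nat) (y : R) :
  Rabs (cos (PI / 2 * y)) <= PI / 2 * Rabs (odd k - y).
Proof.
replace (PI / 2 * y) with (odd k * (PI / 2) - PI / 2 * (odd k - y)) by ring.
rewrite cos_minus, cos_odd_half_PI, sin_odd_half_PI, Rmult_0_l, Rplus_0_l.
rewrite Rabs_mult, pow_1_abs, Rmult_1_l.
apply (Rle_trans _ _ _ (sin_abs_le _)).
rewrite Rabs_mult, (Rabs_pos_eq (PI / 2)) by (pose proof PI_RGT_0; lra); lra.
Qed.

Lemma odd_minus_neq0 (k : nat) (y : R) : cos (PI / 2 * y) <> 0 -> odd k - y <> 0.
Proof.
intros Hy E; pose proof (cos_half_PI_le k y) as H.
rewrite E, Rabs_R0, Rmult_0_r in H.
apply Hy; apply Rabs_eq_0; pose proof (Rabs_pos (cos (PI / 2 * y))); lra.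
Qed.

Lemma odd_plus_neq0 (k : nat) (y : R) : cos (PI / 2 * y) <> 0 -> odd k + y <> 0.
Proof.
intros Hy; replace (odd k + y) with (odd k - - y) by ring.
apply odd_minus_neq0; replace (PI / 2 * - y) with (- (PI / 2 * y)) by ring.
now rewrite cos_neg.
Qed.

Lemma odd_sqr_minus_neq0 (k : nat) (y : R) :
  cos (PI / 2 * y) <> 0 -> odd k ^ 2 - y ^ 2 <> 0.
Proof.
intros Hy; replace (odd k ^ 2 - y ^ 2) with ((odd k - y) * (odd k + y)) by ring.
apply Rmult_integral_contrapositive_currified;
  [now apply odd_minus_neq0|now apply odd_plus_neq0].
Qed.

Lemma Rabs_mult_le_l (a b c : R) : Rabs a <= c -> -1 <= b <= 1 -> Rabs (a * b) <= c.
Proof.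
intros Ha Hb; assert (Hb' : Rabs b <= 1) by now apply Rabs_le.
rewrite Rabs_mult; pose proof (Rabs_pos a); pose proof (Rabs_pos b); nra.
Qed.

(** Apply [kernel_series] to [cos (y * t)]: the [k]-th increment of [A] is the [k]-th term times
    [cos (PI / 2 * y)]. *)
Lemma sec_partial_fractions (y : R) : cos (PI / 2 * y) <> 0 ->
  is_series (fun k => (-1) ^ k * (odd k / (odd k ^ 2 - y ^ 2)))
    (PI / 4 / cos (PI / 2 * y)).
Proof.
intros Hy.
set (A := fun k t => (sin ((odd k + y) * t) / (odd k + y)
                      + sin ((odd k - y) * t) / (odd k - y)) / 2).
assert (HS : is_series (fun k => A k (PI / 2) - A k 0) (PI / 4 * cos (y * 0))).
{ apply (kernel_series (fun t => cos (y * t)) (fun t => - y * sin (y * t))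
           (fun t => - y ^ 2 * cos (y * t)) A (y ^ 2 + Rabs y + 2)).
  - intros t; auto_derive; [exact I|ring].
  - intros t; auto_derive; [exact I|ring].
  - intros t _.
    pose proof (COS_bound (y * t)); pose proof (SIN_bound (y * t)).
    pose proof (COS_bound (y * 0)); pose proof (Rabs_pos y); pose proof (pow2_ge_0 y).
    repeat split.
    + apply Rabs_le; lra.
    + apply Rabs_mult_le_l; rewrite ?Rabs_Ropp; lra.
    + apply Rabs_mult_le_l; rewrite ?Rabs_Ropp, ?(Rabs_pos_eq (y ^ 2)); lra.
  - intros k t; unfold A.
    pose proof (odd_minus_neq0 k y Hy); pose proof (odd_plus_neq0 k y Hy).
    auto_derive; [exact I|].
    replace ((odd k + y) * t) with (odd k * t + y * t) by ring.
    replace ((odd k - y) * t) with (odd k * t - y * t) by ring.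
    rewrite cos_minus, cos_plus; field; auto. }
rewrite Rmult_0_r, cos_0, Rmult_1_r in HS.
apply (is_series_scal_l (/ cos (PI / 2 * y))) in HS.
replace (PI / 4 / cos (PI / 2 * y)) with (scal (/ cos (PI / 2 * y)) (PI / 4))
  by (unfold scal; simpl; unfold mult; simpl; field; exact Hy).
revert HS; apply is_series_ext; intros k; unfold A, scal; simpl; unfold mult; simpl.
rewrite !Rmult_0_r, sin_0.
replace ((odd k + y) * (PI / 2)) with (odd k * (PI / 2) + y * (PI / 2)) by ring.
replace ((odd k - y) * (PI / 2)) with (odd k * (PI / 2) - y * (PI / 2)) by ring.
rewrite sin_minus, sin_plus, cos_odd_half_PI, sin_odd_half_PI, (Rmult_comm y (PI / 2)).
pose proof (odd_minus_neq0 k y Hy); pose proof (odd_plus_neq0 k y Hy).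
pose proof (odd_sqr_minus_neq0 k y Hy); field; repeat split; auto.
simpl in *; lra.
Qed.

(** Apply [kernel_series] to the reflected sine [sin (y * (PI / 2 - t))]. Now [A k] vanishes at
    [PI / 2] and only the endpoint 0 contributes, which removes the alternating sign. *)
Lemma tan_partial_fractions (y : R) : cos (PI / 2 * y) <> 0 -> y <> 0 ->
  is_series (fun k => / (odd k ^ 2 - y ^ 2)) (PI / (4 * y) * tan (PI / 2 * y)).
Proof.
intros Hy Hy0.
set (A := fun k t => (cos (y * (PI / 2) - (odd k + y) * t) / (odd k + y)
                      - cos (y * (PI / 2) + (odd k - y) * t) / (odd k - y)) / 2).
assert (HS : is_series (fun k => A k (PI / 2) - A k 0)
                       (PI / 4 * sin (y * (PI / 2 - 0)))).
{ apply (kernel_series (fun t => sin (y * (PI / 2 - t)))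
           (fun t => - y * cos (y * (PI / 2 - t)))
           (fun t => - y ^ 2 * sin (y * (PI / 2 - t))) A (y ^ 2 + Rabs y + 2)).
  - intros t; auto_derive; [exact I|unfold Rdiv, Rminus; ring].
  - intros t; auto_derive; [exact I|unfold Rdiv, Rminus; ring].
  - intros t _.
    pose proof (COS_bound (y * (PI / 2 - t))); pose proof (SIN_bound (y * (PI / 2 - t))).
    pose proof (SIN_bound (y * (PI / 2 - 0))).
    pose proof (Rabs_pos y); pose proof (pow2_ge_0 y).
    repeat split.
    + apply Rabs_le; lra.
    + apply Rabs_mult_le_l; rewrite ?Rabs_Ropp; lra.
    + apply Rabs_mult_le_l; rewrite ?Rabs_Ropp, ?(Rabs_pos_eq (y ^ 2)); lra.
  - intros k t; unfold A.
    pose proof (odd_minus_neq0 k y Hy); pose proof (odd_plus_neq0 k y Hy).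
    evar_last.
    { auto_derive; [exact I|reflexivity]. }
    replace (y * (PI / 2) + - ((odd k + y) * t))
      with (y * (PI / 2 - t) - odd k * t) by (unfold Rdiv; ring).
    replace (y * (PI / 2) + (odd k - y) * t)
      with (y * (PI / 2 - t) + odd k * t) by (unfold Rdiv; ring).
    rewrite sin_minus, sin_plus; field; auto. }
rewrite Rminus_0_r in HS.
apply (is_series_scal_l (/ (y * cos (PI / 2 * y)))) in HS.
replace (PI / (4 * y) * tan (PI / 2 * y))
  with (scal (/ (y * cos (PI / 2 * y))) (PI / 4 * sin (y * (PI / 2)))).
2:{ unfold scal; simpl; unfold mult; simpl; unfold tan.
    rewrite (Rmult_comm y (PI / 2)); field; auto. }
revert HS; apply is_series_ext; intros k; unfold A, scal; simpl; unfold mult; simpl.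
rewrite !Rmult_0_r, Rminus_0_r, Rplus_0_r.
replace (y * (PI / 2) - (odd k + y) * (PI / 2)) with (- (odd k * (PI / 2))) by ring.
replace (y * (PI / 2) + (odd k - y) * (PI / 2)) with (odd k * (PI / 2)) by ring.
rewrite cos_neg, cos_odd_half_PI, (Rmult_comm y (PI / 2)).
pose proof (odd_minus_neq0 k y Hy); pose proof (odd_plus_neq0 k y Hy).
pose proof (odd_sqr_minus_neq0 k y Hy); field; repeat split; auto.
simpl in *; lra.
Qed.

Lemma sum_inv_odd_sqr : is_series (fun k => / odd k ^ 2) (PI ^ 2 / 8).
Proof.
set (A := fun k t => (PI / 2 - t) * (sin (odd k * t) / odd k) - cos (odd k * t) / odd k ^ 2).
assert (HS : is_series (fun k => A k (PI / 2) - A k 0) (PI / 4 * (PI / 2 - 0))).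
{ apply (kernel_series (fun t => PI / 2 - t) (fun _ => -1) (fun _ => 0) A 4).
  - intros t; auto_derive; [exact I|ring].
  - intros t; auto_derive; [exact I|ring].
  - intros t Ht; pose proof PI_4; repeat split; apply Rabs_le; lra.
  - intros k t; unfold A; pose proof (odd_ge1 k).
    auto_derive; [lra|field; lra]. }
replace (PI ^ 2 / 8) with (PI / 4 * (PI / 2 - 0)) by field.
revert HS; apply is_series_ext; intros k; unfold A; simpl; pose proof (odd_ge1 k).
rewrite Rmult_0_r, cos_odd_half_PI, cos_0, sin_0; field; lra.
Qed.

(* Adding half of the next term turns the alternating sum into a sum of
   differences, whose total variation is bounded by the pole nearest to 0. *)
Lemma alternating_inv_bound (z d : R) (M : nat) : 0 < d ->
  (forall k, d <= Rabs (odd k + z)) ->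
  Rabs (sum_n (fun k => (-1) ^ k / (odd k + z)) M) <= 4 / d.
Proof.
intros Hd Hz.
set (a := fun k => / (odd k + z)).
set (s := sum_n (fun k => (-1) ^ k / (odd k + z)) : nat -> R).
assert (Ha : forall k, - / d <= a k <= / d).
{ intros k; apply Rabs_le_between; unfold a; rewrite Rabs_inv.
  apply Rinv_le_contravar; auto. }
assert (Hn : forall k, odd k + z <> 0).
{ intros k E; pose proof (Hz k) as H; rewrite E, Rabs_R0 in H; lra. }
set (t := fun k => s k - (-1) ^ k * a k / 2).
(* On each side of the pole [a] decreases, so the variation telescopes; the only possible crossing,
   from negative to positive, costs at most [2 / d]. *)
assert (Ht : forall k,
  (odd k + z < 0 -> Rabs (t k - a O / 2) <= (a O - a k) / 2) /\
  (0 < odd k + z -> Rabs (t k - a O / 2) <= (a O - a k) / 2 + 2 / d)).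
{ assert (P2 : 0 < / d) by now apply Rinv_0_lt_compat.
  induction k as [|k [IH1 IH2]].
  - assert (E : t O - a O / 2 = 0).
    { unfold t, s, a; rewrite sum_n_0; simpl; pose proof (Hn O); field; auto. }
    rewrite E, Rabs_R0; split; intros _; lra.
  - assert (E : t (S k) - a O / 2 = (t k - a O / 2) + (-1) ^ k * ((a k - a (S k)) / 2)).
    { unfold t, s; rewrite sum_n_S; unfold a; simpl.
      pose proof (Hn k); pose proof (Hn (S k)); field; auto. }
    assert (B : Rabs (t (S k) - a O / 2) <= Rabs (t k - a O / 2) + Rabs ((a k - a (S k)) / 2)).
    { rewrite E; apply (Rle_trans _ _ _ (Rabs_triang _ _)).
      rewrite Rabs_mult, pow_1_abs; lra. }
    assert (Hodd : odd (S k) = odd k + 2) by apply odd_S.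
    assert (Hdiff : a k - a (S k) = 2 / ((odd k + z) * (odd (S k) + z))).
    { unfold a; rewrite Hodd; pose proof (Hn k); pose proof (Hn (S k)) as Hnk.
      rewrite Hodd in Hnk; field; auto. }
    assert (Hsame : 0 < (odd k + z) * (odd (S k) + z) ->
      Rabs ((a k - a (S k)) / 2) = (a k - a (S k)) / 2).
    { intros Hp; apply Rabs_pos_eq; rewrite Hdiff.
      apply Rinv_0_lt_compat in Hp; unfold Rdiv; lra. }
    split; intros Hs.
    + assert (Hk : odd k + z < 0) by lra.
      rewrite Hsame in B by (clear - Hs Hk; nra); specialize (IH1 Hk); lra.
    + destruct (Rdichotomy _ _ (Hn k)) as [Hk|Hk].
      * specialize (IH1 Hk).
        assert (Hak : a k < 0) by now apply Rinv_lt_0_compat.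
        assert (HaS : 0 < a (S k)) by now apply Rinv_0_lt_compat.
        rewrite (Rabs_left ((a k - a (S k)) / 2)) in B by lra.
        pose proof (Ha k); pose proof (Ha (S k)); lra.
      * specialize (IH2 Hk); rewrite Hsame in B by (clear - Hs Hk; nra); lra. }
assert (B : Rabs (t M - a O / 2) <= / d + 2 / d).
{ assert (P2 : 0 < / d) by now apply Rinv_0_lt_compat.
  pose proof (Ha O); pose proof (Ha M); destruct (Ht M) as [H1 H2].
  destruct (Rdichotomy _ _ (Hn M)) as [Hk|Hk];
    [specialize (H1 Hk)|specialize (H2 Hk)]; lra. }
assert (E : s M = (t M - a O / 2) + a O / 2 + (-1) ^ M * (a M / 2)).
{ unfold t; field. }
change (Rabs (s M) <= 4 / d); rewrite E.
assert (B2 : Rabs ((-1) ^ M * (a M / 2)) <= / d / 2).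
{ rewrite Rabs_mult, pow_1_abs, Rmult_1_l; apply Rabs_le; pose proof (Ha M); lra. }
assert (B3 : Rabs (a O / 2) <= / d / 2) by (apply Rabs_le; pose proof (Ha O); lra).
pose proof (Rabs_triang (t M - a O / 2 + a O / 2) ((-1) ^ M * (a M / 2))).
pose proof (Rabs_triang (t M - a O / 2) (a O / 2)); lra.
Qed.

(** Each term is half the sum of the terms with denominators [odd k - y] and [odd k + y], and
    [cos_half_PI_le] keeps both poles at distance [d]. Uniformity in [M] later supplies the majorant
    for the exchange. *)
Lemma sec_partial_sum_bound (y : R) (M : nat) : cos (PI / 2 * y) <> 0 ->
  Rabs (sum_n (fun k => (-1) ^ k * (odd k / (odd k ^ 2 - y ^ 2))) M)
  <= 2 * PI / Rabs (cos (PI / 2 * y)).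
Proof.
intros Hy; pose proof PI_RGT_0 as HP.
pose proof (Rabs_pos_lt _ Hy) as HD.
set (d := 2 / PI * Rabs (cos (PI / 2 * y))).
assert (Hd : 0 < d) by (apply Rmult_lt_0_compat; [apply Rdiv_lt_0_compat; lra|lra]).
assert (Hm : forall k, d <= Rabs (odd k + - y)).
{ intros k; change (odd k + - y) with (odd k - y).
  apply (Rmult_le_reg_l (PI / 2)); [lra|].
  replace (PI / 2 * d) with (Rabs (cos (PI / 2 * y))) by (unfold d; field; lra).
  apply cos_half_PI_le. }
assert (Hp : forall k, d <= Rabs (odd k + y)).
{ intros k; replace (odd k + y) with (odd k - - y) by ring.
  apply (Rmult_le_reg_l (PI / 2)); [lra|].
  replace (PI / 2 * d) with (Rabs (cos (PI / 2 * - y))); [apply cos_half_PI_le|].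
  replace (PI / 2 * - y) with (- (PI / 2 * y)) by ring.
  rewrite cos_neg; unfold d; field; lra. }
pose proof (alternating_inv_bound (- y) d M Hd Hm) as B1.
pose proof (alternating_inv_bound y d M Hd Hp) as B2.
replace (sum_n (fun k => (-1) ^ k * (odd k / (odd k ^ 2 - y ^ 2))) M)
  with ((sum_n (fun k => (-1) ^ k / (odd k + - y)) M
         + sum_n (fun k => (-1) ^ k / (odd k + y)) M) / 2).
- replace (2 * PI / Rabs (cos (PI / 2 * y))) with (4 / d) by (unfold d; field; lra).
  revert B1 B2; unfold Rabs; repeat destruct Rcase_abs; lra.
- assert (E : forall k, (-1) ^ k * (odd k / (odd k ^ 2 - y ^ 2))
                        = ((-1) ^ k / (odd k + - y) + (-1) ^ k / (odd k + y)) / 2).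
  { intros k; pose proof (odd_minus_neq0 k y Hy); pose proof (odd_plus_neq0 k y Hy).
    pose proof (odd_sqr_minus_neq0 k y Hy).
    field; repeat split; auto; simpl in *; lra. }
  induction M as [|M IH]; rewrite ?sum_n_0, ?sum_n_S, E; [reflexivity|].
  rewrite <- IH; [lra| |]; now apply alternating_inv_bound.
Qed.

(** * Sums over separated points *)

Definition inv_sum (l : list nat) : R := fold_right (fun j r => / INR j + r) 0 l.

Lemma inv_sum_app (l1 l2 : list nat) : inv_sum (l1 ++ l2) = inv_sum l1 + inv_sum l2.
Proof. induction l1 as [|j l1 IH]; simpl; [lra|rewrite IH; lra]. Qed.

(** Among [n] distinct positive integers one is at least [n]; remove it and induct. The square root
    is a crude substitute for the logarithmic size of a harmonic sum. *)
Lemma inv_sum_le (l : list nat) : NoDup l -> (forall j, In j l -> (1 <= j)%nat) ->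
  inv_sum l <= 2 * sqrt (INR (length l)).
Proof.
remember (length l) as n eqn:Hn; revert l Hn.
induction n as [|n IH]; intros l Hn Hd H1.
- destruct l; [simpl; rewrite sqrt_0; lra|discriminate].
- assert (Hex : Exists (fun j => (S n <= j)%nat) l).
  { destruct (Exists_dec (fun j => (S n <= j)%nat) l) as [H|H]; [|exact H|].
    - intros j; destruct (le_dec (S n) j); [left|right]; assumption.
    - exfalso; apply Forall_Exists_neg in H; rewrite Forall_forall in H.
      assert (Hi : incl l (seq 1 n)).
      { intros j Hj; apply in_seq; specialize (H j Hj); specialize (H1 j Hj); lia. }
      pose proof (NoDup_incl_length Hd Hi) as HL; rewrite length_seq in HL; lia. }
  apply Exists_exists in Hex; destruct Hex as [j [Hj Hjn]].
  apply in_split in Hj; destruct Hj as [l1 [l2 ->]].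
  assert (Hb : inv_sum (l1 ++ l2) <= 2 * sqrt (INR n)).
  { apply IH.
    - rewrite length_app in *; simpl in Hn; lia.
    - now apply NoDup_remove_1 in Hd.
    - intros i Hi; apply H1; apply in_app_iff in Hi; apply in_app_iff; simpl; tauto. }
  rewrite inv_sum_app in *; simpl.
  assert (Hj : / INR j <= / INR (S n)).
  { apply Rinv_le_contravar; [apply lt_0_INR; lia|apply le_INR; lia]. }
  pose proof (pos_INR n) as Hn0.
  pose proof (sqrt_pos (INR n)) as P0; pose proof (sqrt_sqrt (INR n) Hn0) as E0.
  assert (P1 : 0 < sqrt (INR (S n))) by (apply sqrt_lt_R0; rewrite S_INR; lra).
  assert (E1 : sqrt (INR (S n)) * sqrt (INR (S n)) = INR n + 1)
    by (rewrite sqrt_sqrt, S_INR; [reflexivity|rewrite S_INR; lra]).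
  assert (Hs : / INR (S n) <= 2 * (sqrt (INR (S n)) - sqrt (INR n))).
  { rewrite S_INR in *; apply (Rmult_le_reg_l (INR n + 1)); [lra|].
    rewrite Rinv_r by lra; rewrite <- E1 at 1.
    assert (Hle : sqrt (INR n) <= sqrt (INR n + 1)) by (apply sqrt_le_1_alt; lra).
    set (r := sqrt (INR n)) in *; set (t := sqrt (INR n + 1)) in *.
    assert (Ht1 : 1 <= t) by nra.
    assert (Hrt : (t + r) * (t - r) = 1) by lra.
    assert (H2 : (t + r) * (t - r) <= 2 * t * (t - r)) by (apply Rmult_le_compat_r; lra).
    assert (H3 : 2 * t * (t - r) <= t * (2 * t * (t - r))) by nra.
    lra. }
  change (inv_sum l1 + (/ INR j + inv_sum l2) <= 2 * sqrt (INR (S n))); lra.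
Qed.

(** Separation by [s] makes the integer parts of [y i / s] distinct and positive, which reduces the
    sum to one over reciprocals of distinct integers. *)
Lemma separated_inv_sum (y : nat -> R) (s : R) (X : nat) : 0 < s ->
  (forall i, (i <= X)%nat -> s <= y i) ->
  (forall i j, (i <= X)%nat -> (j <= X)%nat -> i <> j -> s <= Rabs (y i - y j)) ->
  sum_n (fun i => / y i) X <= / s * (2 * sqrt (INR (S X))).
Proof.
intros Hs Hy Hsep.
set (fl := fun i => Z.to_nat (Int_part (y i / s))).
assert (Hfl : forall i, (i <= X)%nat -> (1 <= fl i)%nat /\ INR (fl i) <= y i / s < INR (fl i) + 1).
{ intros i Hi; specialize (Hy i Hi).
  destruct (base_Int_part (y i / s)) as [B1 B2].
  assert (H1 : 1 <= y i / s).
  { apply (Rmult_le_reg_r s); [lra|]; unfold Rdiv; rewrite Rmult_assoc, Rinv_l; lra. }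
  assert (HZ : (0 < Int_part (y i / s))%Z) by (apply lt_IZR; lra).
  unfold fl; rewrite INR_IZR_INZ, Z2Nat.id by lia; split; [lia|lra]. }
assert (Hinj : forall i j, (i <= X)%nat -> (j <= X)%nat -> fl i = fl j -> i = j).
{ intros i j Hi Hj E; destruct (Nat.eq_dec i j) as [|Hne]; [assumption|exfalso].
  destruct (Hfl i Hi) as [_ Bi]; destruct (Hfl j Hj) as [_ Bj]; rewrite E in Bi.
  specialize (Hsep i j Hi Hj Hne).
  assert (Rabs (y i / s - y j / s) < 1) by (apply Rabs_def1; lra).
  assert (Ey : y i - y j = s * (y i / s - y j / s)) by (field; lra).
  rewrite Ey, Rabs_mult, (Rabs_pos_eq s) in Hsep by lra; nra. }
assert (Hsum : forall n, (n <= X)%nat ->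
  sum_n (fun i => / y i) n <= / s * inv_sum (map fl (seq 0 (S n)))).
{ assert (Hterm : forall i, (i <= X)%nat -> / y i <= / s * / INR (fl i)).
  { intros i Hi; destruct (Hfl i Hi) as [F1 [F2 _]]; specialize (Hy i Hi).
    assert (0 < INR (fl i)) by (apply lt_0_INR; lia).
    rewrite <- Rinv_mult; apply Rinv_le_contravar; [apply Rmult_lt_0_compat; lra|].
    apply (Rmult_le_compat_l s) in F2; [|lra].
    replace (s * (y i / s)) with (y i) in F2 by (field; lra); lra. }
  induction n as [|n IH]; intros Hn.
  - rewrite sum_n_0; simpl; rewrite Rplus_0_r; apply Hterm; lia.
  - rewrite sum_n_S, seq_S, map_app, inv_sum_app.
    specialize (IH ltac:(lia)); pose proof (Hterm (S n) Hn) as Ht.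
    cbn [map inv_sum fold_right Nat.add]; rewrite Rplus_0_r, Rmult_plus_distr_l; lra. }
apply (Rle_trans _ _ _ (Hsum X (Nat.le_refl X))).
apply Rmult_le_compat_l; [left; now apply Rinv_0_lt_compat|].
replace (S X) with (length (map fl (seq 0 (S X)))) at 2
  by (rewrite length_map, length_seq; reflexivity).
apply inv_sum_le.
- apply NoDup_map_NoDup_ForallPairs; [|apply seq_NoDup].
  intros i j Hi Hj; apply in_seq in Hi; apply in_seq in Hj; apply Hinj; lia.
- intros j Hj; apply in_map_iff in Hj; destruct Hj as [i [<- Hi]].
  apply in_seq in Hi; apply Hfl; lia.
Qed.

Lemma ex_series_abel (a : nat -> R) (C : R) : (forall k, 0 <= a k) ->
  (forall X, sum_n a X <= C * (INR (S X) * sqrt (INR (S X)))) ->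
  ex_series (fun k => a k / INR (S k) ^ 2).
Proof.
intros Ha HA.
assert (HC : 0 <= C).
{ specialize (HA O); rewrite sum_n_0 in HA; simpl in HA.
  rewrite sqrt_1 in HA; specialize (Ha O); lra. }
assert (HSpos : forall k, 0 < INR (S k)) by (intros k; apply lt_0_INR; lia).
(* Summation by parts as an invariant: a boundary term plus a telescoping majorant of the remaining
   sum. They are bounded by [C] and [4 * C], whence the final [5 * C]. *)
assert (Hinv : forall n, sum_n (fun k => a k / INR (S k) ^ 2) n
  <= sum_n a n / INR (S n) ^ 2 + 4 * C * (1 - / sqrt (INR (S n)))).
{ induction n as [|n IH].
  - rewrite !sum_n_0; simpl; rewrite sqrt_1; lra.
  - rewrite !sum_n_S.
    pose proof (HSpos n) as Hv; set (v := INR (S n)) in *.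
    assert (Ev : INR (S (S n)) = v + 1) by apply S_INR.
    rewrite Ev.
    assert (Hr : 0 < sqrt v) by now apply sqrt_lt_R0.
    assert (Hr1 : 0 < sqrt (v + 1)) by (apply sqrt_lt_R0; lra).
    assert (Er : sqrt v * sqrt v = v) by (apply sqrt_sqrt; lra).
    assert (Er1 : sqrt (v + 1) * sqrt (v + 1) = v + 1) by (apply sqrt_sqrt; lra).
    assert (Hrr : sqrt v <= sqrt (v + 1)) by (apply sqrt_le_1_alt; lra).
    assert (Hd : 0 <= / v ^ 2 - / (v + 1) ^ 2).
    { assert (/ (v + 1) ^ 2 <= / v ^ 2) by (apply Rinv_le_contravar; nra); lra. }
    assert (H1 : sum_n a n * (/ v ^ 2 - / (v + 1) ^ 2)
                 <= C * (v * sqrt v) * (/ v ^ 2 - / (v + 1) ^ 2)).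
    { apply Rmult_le_compat_r; [exact Hd|apply HA]. }
    assert (H2 : (v * sqrt v) * (/ v ^ 2 - / (v + 1) ^ 2)
                 <= 4 * (/ sqrt v - / sqrt (v + 1))).
    { set (r := sqrt v) in *; set (t := sqrt (v + 1)) in *.
      replace (v * r * (/ v ^ 2 - / (v + 1) ^ 2))
        with ((2 * v + 1) * r / (v * (v + 1) ^ 2)) by (field; lra).
      replace (/ r - / t) with (/ (r * t * (t + r))).
      2:{ replace (/ r - / t) with ((t - r) * (t + r) / (r * t * (t + r))) by (field; lra).
          replace ((t - r) * (t + r)) with 1 by lra.
          unfold Rdiv; ring. }
      assert (L : (2 * v + 1) * r / (v * (v + 1) ^ 2) <= 2 / (r * (v + 1))).
      { replace ((2 * v + 1) * r / (v * (v + 1) ^ 2))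
          with ((2 * v + 1) / (v + 1) * / (r * (v + 1))).
        2:{ assert (Hrv : r / v = / r) by (rewrite <- Er; field; lra).
            replace ((2 * v + 1) * r / (v * (v + 1) ^ 2))
              with ((2 * v + 1) * (r / v) / (v + 1) ^ 2) by (field; lra).
            rewrite Hrv; field; lra. }
        apply Rmult_le_compat_r; [left; apply Rinv_0_lt_compat; nra|].
        apply (Rmult_le_reg_r (v + 1)); [lra|]; unfold Rdiv.
        rewrite Rmult_assoc, Rinv_l; lra. }
      assert (L2 : / (2 * (r * (v + 1))) <= / (r * t * (t + r))).
      { apply Rinv_le_contravar; [repeat apply Rmult_lt_0_compat; lra|].
        replace (2 * (r * (v + 1))) with (r * t * (2 * t)) by (rewrite <- Er1; ring).
        apply Rmult_le_compat_l; [left; apply Rmult_lt_0_compat; lra|lra]. }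
      rewrite Rinv_mult in L2; unfold Rdiv in L; lra. }
    assert (H3 : C * ((v * sqrt v) * (/ v ^ 2 - / (v + 1) ^ 2))
                 <= C * (4 * (/ sqrt v - / sqrt (v + 1)))) by now apply Rmult_le_compat_l.
    unfold Rdiv in *; lra. }
destruct (ex_finite_lim_seq_incr (sum_n (fun k => a k / INR (S k) ^ 2)) (5 * C)) as [l Hl].
- intros n; rewrite sum_n_S.
  assert (0 <= a (S n) / INR (S (S n)) ^ 2); [|lra].
  apply Rdiv_le_0_compat; [apply Ha|apply pow_lt, HSpos].
- intros n; apply (Rle_trans _ _ _ (Hinv n)).
  pose proof (HSpos n) as Hv; specialize (HA n).
  set (v := INR (S n)) in *.
  assert (Hv1 : 1 <= v) by (unfold v; rewrite S_INR; pose proof (pos_INR n); lra).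
  assert (Hr : 1 <= sqrt v) by (rewrite <- sqrt_1; now apply sqrt_le_1_alt).
  assert (Er : sqrt v * sqrt v = v) by (apply sqrt_sqrt; lra).
  assert (B1 : sum_n a n / v ^ 2 <= C).
  { apply (Rmult_le_reg_r (v ^ 2)); [apply pow_lt; lra|].
    unfold Rdiv; rewrite Rmult_assoc, Rinv_l, Rmult_1_r by (apply pow_nonzero; lra).
    apply (Rle_trans _ _ _ HA), Rmult_le_compat_l; [lra|].
    simpl; rewrite Rmult_1_r; apply Rmult_le_compat_l; nra. }
  assert (0 < / sqrt v) by (apply Rinv_0_lt_compat; lra).
  assert (C * (1 - / sqrt v) <= C * 1) by (apply Rmult_le_compat_l; lra).
  lra.
- exists l; exact Hl.
Qed.

(** * Badly approximable numbers *)

(* Testing against [|m| + |n|] rather than [|n|] makes the notion visibly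
   invariant under integral Moebius transformations. *)
Definition badly_approximable (th : R) : Prop :=
  exists c, 0 < c /\ forall m n : Z, (m <> 0 \/ n <> 0)%Z ->
    c <= Rabs (IZR m - th * IZR n) * (Rabs (IZR m) + Rabs (IZR n)).

Lemma IZR_odd (k : nat) : IZR (2 * Z.of_nat k + 1) = odd k.
Proof. unfold odd; rewrite plus_IZR, mult_IZR, <- INR_IZR_INZ; reflexivity. Qed.

Lemma trig_shift_even (x : R) (i : Z) :
  cos (x + IZR (2 * i) * PI) = cos x /\ sin (x + IZR (2 * i) * PI) = sin x.
Proof.
rewrite mult_IZR; destruct (Z_le_dec 0 i) as [Hi|Hi].
- rewrite <- (Z2Nat.id i) by assumption; rewrite <- INR_IZR_INZ.
  split; [apply cos_period|apply sin_period].
- set (z := x + 2 * IZR i * PI).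
  assert (E : x = z + 2 * INR (Z.to_nat (- i)) * PI).
  { unfold z; rewrite INR_IZR_INZ, Z2Nat.id, opp_IZR by lia; ring. }
  rewrite E; split; symmetry; [apply cos_period|apply sin_period].
Qed.

Lemma trig_shift (x : R) (i : Z) :
  let e := if Z.even i then 1 else -1 in
  cos (x + IZR i * PI) = e * cos x /\ sin (x + IZR i * PI) = e * sin x.
Proof.
simpl; destruct (Z.even i) eqn:E.
- apply Z.even_spec in E; destruct E as [j ->].
  destruct (trig_shift_even x j) as [-> ->]; split; ring.
- assert (O : Z.odd i = true) by (rewrite <- Z.negb_even, E; reflexivity).
  apply Z.odd_spec in O; destruct O as [j ->].
  replace (x + IZR (2 * j + 1) * PI) with (x + IZR (2 * j) * PI + PI)
    by (rewrite plus_IZR; ring).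
  rewrite neg_cos, neg_sin; destruct (trig_shift_even x j) as [-> ->]; split; ring.
Qed.

(** * Absolute convergence of the secant series *)

Section SecantSummable.
Variables (th : R) (c : R).
Hypothesis c_pos : 0 < c.
Hypothesis th_bad : forall m n : Z, (m <> 0 \/ n <> 0)%Z ->
    c <= Rabs (IZR m - th * IZR n) * (Rabs (IZR m) + Rabs (IZR n)).

(** A nearest odd integer to [th * odd k]; [l k] below is the signed distance. *)
Let m (k : nat) : Z := (2 * Int_part (th * odd k / 2) + 1)%Z.
Let l (k : nat) : R := IZR (m k) - th * odd k.

Let l_le1 (k : nat) : Rabs (l k) <= 1.
Proof.
unfold l, m; rewrite plus_IZR, mult_IZR.
destruct (base_Int_part (th * odd k / 2)); apply Rabs_le; lra.
Qed.

(** Up to sign the cosine is the sine of [PI / 2 * l k], and [sin_lower] together with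
    [PI / 2 > 3 / 2] gives the factor one half. *)
Let cos_ge (k : nat) : Rabs (l k) / 2 <= Rabs (cos (PI / 2 * (th * odd k))).
Proof.
set (i := Int_part (th * odd k / 2)).
replace (PI / 2 * (th * odd k)) with ((PI / 2 - PI / 2 * l k) + IZR i * PI).
2:{ unfold l, m; fold i; rewrite plus_IZR, mult_IZR; field. }
destruct (trig_shift (PI / 2 - PI / 2 * l k) i) as [-> _].
rewrite Rabs_mult, cos_shift.
replace (Rabs (if Z.even i then 1 else -1)) with 1
  by (destruct (Z.even i); unfold Rabs; destruct Rcase_abs; lra).
rewrite Rmult_1_l; pose proof PI2_3_2 as HP.
assert (H : forall x, 0 <= x <= 1 -> x / 2 <= sin (PI / 2 * x)).
{ intros x Hx; pose proof (sin_lower (PI / 2 * x) ltac:(nra)); nra. }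
pose proof (l_le1 k) as Hl.
destruct (Rle_dec 0 (l k)) as [Hp|Hp].
- rewrite (Rabs_pos_eq (l k)) in * by lra.
  apply (Rle_trans _ _ _ (H (l k) ltac:(lra))), Rle_abs.
- rewrite (Rabs_left (l k)) in * by lra.
  apply (Rle_trans _ _ _ (H (- l k) ltac:(lra))).
  replace (PI / 2 * - l k) with (- (PI / 2 * l k)) by ring.
  rewrite sin_neg, <- Rabs_Ropp; apply Rle_abs.
Qed.

(** Chosen so that sums and differences of two lattice points [(m k, odd k)] with [k <= X] have
    absolute coordinates adding up to at most [D * INR (S X)]. *)
Let D : R := 8 + 4 * Rabs th.

Let m_le (X k : nat) : (k <= X)%nat ->
  Rabs (IZR (m k)) <= 1 + Rabs th * odd X /\ 1 <= odd k <= odd X.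
Proof.
intros Hk; pose proof (odd_ge1 k) as H1.
assert (H2 : odd k <= odd X) by (unfold odd; pose proof (le_INR _ _ Hk); lra).
split; [|lra].
replace (IZR (m k)) with (l k + th * odd k) by (unfold l; ring).
apply (Rle_trans _ _ _ (Rabs_triang _ _)).
rewrite Rabs_mult, (Rabs_pos_eq (odd k)) by lra.
pose proof (l_le1 k); pose proof (Rabs_pos th); nra.
Qed.

Let separation (X : nat) (a b : Z) : (a <> 0 \/ b <> 0)%Z ->
  Rabs (IZR a) + Rabs (IZR b) <= 2 * (1 + Rabs th * odd X) + 2 * odd X ->
  c / (D * INR (S X)) <= Rabs (IZR a - th * IZR b).
Proof.
intros Hab Hle; pose proof (Rabs_pos th) as Ht; pose proof (pos_INR X) as HX.
assert (HD : 2 * (1 + Rabs th * odd X) + 2 * odd X <= D * INR (S X)).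
{ unfold D, odd; rewrite S_INR.
  pose proof (Rmult_le_pos _ _ Ht HX); lra. }
assert (HP : 0 < D * INR (S X)) by (apply Rmult_lt_0_compat; [unfold D|rewrite S_INR]; lra).
apply (Rmult_le_reg_r (D * INR (S X))); [exact HP|].
unfold Rdiv; rewrite Rmult_assoc, Rinv_l, Rmult_1_r by lra.
apply (Rle_trans _ _ _ (th_bad a b Hab)).
apply Rmult_le_compat_l; [apply Rabs_pos|lra].
Qed.

Let oddZ (k : nat) : Z := (2 * Z.of_nat k + 1)%Z.

(* [|l i| - |l j|] is [l i - l j] or [l i + l j] up to sign, so both the
   differences and the sums of the lattice points have to be nonzero. *)
Lemma cos_inv_partial_sum (X : nat) :
  sum_n (fun k => / Rabs (l k)) X <= D / c * 2 * (INR (S X) * sqrt (INR (S X))).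
Proof.
pose proof (Rabs_pos th) as Ht; pose proof (pos_INR X) as HX.
assert (HSX : 0 < INR (S X)) by (apply lt_0_INR; lia).
assert (HD : 0 < D) by (unfold D; lra).
assert (Hs : 0 < c / (D * INR (S X))) by (apply Rdiv_lt_0_compat; [lra|nra]).
eapply Rle_trans.
- apply (separated_inv_sum (fun k => Rabs (l k)) (c / (D * INR (S X))) X Hs).
  + intros k Hk; destruct (m_le X k Hk) as [M1 M2].
    unfold l; rewrite <- IZR_odd; fold (oddZ k).
    apply separation; [right; unfold oddZ; lia|].
    unfold oddZ; rewrite IZR_odd, (Rabs_pos_eq (odd k)) by lra.
    pose proof (Rmult_le_pos (Rabs th) (odd X) Ht ltac:(lra)); lra.
  + intros i j Hi Hj Hij; destruct (m_le X i Hi) as [M1 M2]; destruct (m_le X j Hj) as [M3 M4].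
    assert (B1 : c / (D * INR (S X)) <= Rabs (l i - l j)).
    { replace (l i - l j) with (IZR (m i - m j) - th * IZR (oddZ i - oddZ j)).
      2:{ unfold oddZ; rewrite !minus_IZR, !IZR_odd; unfold l; ring. }
      apply separation; [right; unfold oddZ; lia|].
      unfold oddZ; rewrite !minus_IZR, !IZR_odd.
      revert M1 M3; unfold Rabs; repeat destruct Rcase_abs; lra. }
    assert (B2 : c / (D * INR (S X)) <= Rabs (l i + l j)).
    { replace (l i + l j) with (IZR (m i + m j) - th * IZR (oddZ i + oddZ j)).
      2:{ unfold oddZ; rewrite (plus_IZR (m i)), (plus_IZR (2 * _ + 1)), !IZR_odd.
          unfold l; ring. }
      apply separation; [right; unfold oddZ; lia|].
      unfold oddZ; rewrite (plus_IZR (m i)), (plus_IZR (2 * _ + 1)), !IZR_odd.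
      rewrite (Rabs_pos_eq (odd i + odd j)) by lra.
      pose proof (Rabs_triang (IZR (m i)) (IZR (m j))); lra. }
    revert B1 B2; generalize (c / (D * INR (S X))); intros s B1 B2.
    revert B1 B2; unfold Rabs; repeat destruct Rcase_abs; lra.
- right; field; repeat split; lra.
Qed.

(** By [cos_ge] it is enough to sum reciprocals of [l k]; their partial sums grow like the power 3/2
    of [X], which the quadratic weight beats by [ex_series_abel]. *)
Lemma secant_summable : ex_series (fun k => / (odd k ^ 2 * Rabs (cos (PI / 2 * (th * odd k))))).
Proof.
assert (Hl : forall k, 0 < Rabs (l k)).
{ intros k; apply Rabs_pos_lt; intros E.
  pose proof (th_bad (m k) (oddZ k) ltac:(unfold oddZ; right; lia)) as H.
  unfold oddZ in H at 1; rewrite IZR_odd in H; fold (l k) in H.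
  rewrite E, Rabs_R0, Rmult_0_l in H; lra. }
apply (ex_series_le (V := R_CompleteNormedModule) _
         (fun k => 2 * (/ Rabs (l k) / INR (S k) ^ 2))).
- intros k.
  change (Rabs (/ (odd k ^ 2 * Rabs (cos (PI / 2 * (th * odd k)))))
          <= 2 * (/ Rabs (l k) / INR (S k) ^ 2)).
  pose proof (odd_ge1 k) as Ho; pose proof (cos_ge k) as Hc; specialize (Hl k).
  assert (HS : 0 < INR (S k)) by (apply lt_0_INR; lia).
  assert (HSo : INR (S k) <= odd k) by (unfold odd; rewrite S_INR; pose proof (pos_INR k); lra).
  rewrite Rabs_pos_eq by (left; apply Rinv_0_lt_compat, Rmult_lt_0_compat; [apply pow_lt|]; lra).
  replace (2 * (/ Rabs (l k) / INR (S k) ^ 2))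
    with (/ (INR (S k) ^ 2 * (Rabs (l k) / 2))) by (field; lra).
  apply Rinv_le_contravar; [apply Rmult_lt_0_compat; [apply pow_lt|]; lra|].
  apply Rmult_le_compat; [apply pow_le; lra|lra| |lra].
  apply pow_incr; lra.
- apply (ex_series_scal_l (V := R_NormedModule) 2
           (fun k => / Rabs (l k) / INR (S k) ^ 2)).
  apply (ex_series_abel _ (D / c * 2)).
  + intros k; left; apply Rinv_0_lt_compat, Hl.
  + exact cos_inv_partial_sum.
Qed.

End SecantSummable.

(** * Exchanging the double series *)

Lemma series_tail_bound (a B : nat -> R) (N : nat) : (forall n, Rabs (a n) <= B n) ->
  ex_series B -> Rabs (Series a - sum_n a N) <= Series B - sum_n B N.
Proof.
intros Ha HB.
assert (Hexa : ex_series (fun n => Rabs (a n))).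
{ apply (ex_series_le (V := R_CompleteNormedModule) _ B); [|exact HB].
  intros n; change (Rabs (Rabs (a n)) <= B n); now rewrite Rabs_Rabsolu. }
rewrite (Series_incr_n a (S N)), (Series_incr_n B (S N)) by (lia || auto using ex_series_Rabs).
simpl Init.Nat.pred; rewrite !sum_n_Reals.
replace (sum_f_R0 a N + Series (fun k => a (S N + k)%nat) - sum_f_R0 a N)
  with (Series (fun k => a (S N + k)%nat)) by ring.
replace (sum_f_R0 B N + Series (fun k => B (S N + k)%nat) - sum_f_R0 B N)
  with (Series (fun k => B (S N + k)%nat)) by ring.
eapply Rle_trans.
- apply Series_Rabs; exact (proj1 (ex_series_incr_n (fun n => Rabs (a n)) (S N)) Hexa).
- apply Series_le; [|exact (proj1 (ex_series_incr_n B (S N)) HB)].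
  intros n; split; [apply Rabs_pos|apply Ha].
Qed.

Lemma is_lim_seq_sum_n (g : nat -> nat -> R) (h : nat -> R) (N : nat) :
  (forall n, is_lim_seq (fun M => g M n) (h n)) ->
  is_lim_seq (fun M => sum_n (g M) N) (sum_n h N).
Proof.
intros H; induction N as [|N IH].
- rewrite sum_n_0; apply (is_lim_seq_ext (fun M => g M 0%nat)); [|apply H].
  intros M; now rewrite sum_n_0.
- rewrite sum_n_S; apply (is_lim_seq_ext (fun M => sum_n (g M) N + g M (S N))).
  + intros M; now rewrite sum_n_S.
  + now apply is_lim_seq_plus'.
Qed.

(** Dominated convergence for series: the tail of [B] controls the tails of [g M] and [h] uniformly
    in [M], and finitely many terms remain. *)
Lemma tannery (g : nat -> nat -> R) (h B : nat -> R) :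
  (forall M n, Rabs (g M n) <= B n) -> ex_series B ->
  (forall n, is_lim_seq (fun M => g M n) (h n)) ->
  ex_series h /\ is_lim_seq (fun M => Series (g M)) (Series h).
Proof.
intros Hg HB Hlim.
assert (Hh : forall n, Rabs (h n) <= B n).
{ intros n.
  apply (is_lim_seq_le (fun M => Rabs (g M n)) (fun _ => B n) (Rabs (h n)) (B n)).
  - intros M; apply Hg.
  - exact (is_lim_seq_abs _ _ (Hlim n)).
  - apply is_lim_seq_const. }
split; [now apply (ex_series_le (V := R_CompleteNormedModule) _ B)|].
apply is_lim_seq_spec; intros [e He]; simpl.
assert (Htail : exists N, Series B - sum_n B N < e / 4).
{ assert (HS : is_lim_seq (sum_n B) (Series B)) by exact (Series_correct _ HB).
  apply is_lim_seq_spec in HS.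
  assert (He4 : 0 < e / 4) by lra.
  destruct (HS (mkposreal _ He4)) as [N HN]; exists N.
  specialize (HN N (Nat.le_refl N)); simpl in HN.
  apply Rabs_def2 in HN; lra. }
destruct Htail as [N HN].
pose proof (is_lim_seq_sum_n g h N Hlim) as HL; apply is_lim_seq_spec in HL.
assert (He4 : 0 < e / 4) by lra.
destruct (HL (mkposreal _ He4)) as [M0 HM]; exists M0; intros M HMM.
specialize (HM M HMM); simpl in HM.
pose proof (series_tail_bound (g M) B N (Hg M) HB) as T1.
pose proof (series_tail_bound h B N Hh HB) as T2.
apply Rabs_def2 in HM; apply Rabs_le_between in T1; apply Rabs_le_between in T2.
apply Rabs_def1; lra.
Qed.

Lemma is_series_sum_n (a : nat -> nat -> R) (v : nat -> R) (M : nat) :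
  (forall m, is_series (fun n => a n m) (v m)) ->
  is_series (fun n => sum_n (a n) M) (sum_n v M).
Proof.
intros H; induction M as [|M IH].
- rewrite sum_n_0; apply (is_series_ext (fun n => a n 0%nat)); [|apply H].
  intros n; now rewrite sum_n_0.
- rewrite sum_n_S; apply (is_series_ext (fun n => sum_n (a n) M + a n (S M))).
  + intros n; now rewrite sum_n_S.
  + exact (is_series_plus _ _ _ _ IH (H (S M))).
Qed.

Lemma cos_half_PI_neq0 (y : R) : (forall i, y <> IZR (2 * i + 1)) -> cos (PI / 2 * y) <> 0.
Proof.
intros Hy E; apply cos_eq_0_0 in E; destruct E as [i Hi].
apply (Hy i); rewrite plus_IZR, mult_IZR; pose proof PI_RGT_0.
apply (Rmult_eq_reg_l (PI / 2)); [|lra]; rewrite Hi; field.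
Qed.

Lemma badly_approximable_neq (th : R) (m n : Z) : badly_approximable th ->
  (m <> 0 \/ n <> 0)%Z -> IZR m <> th * IZR n.
Proof.
intros [c [Hc H]] Hmn E; specialize (H m n Hmn).
rewrite E, Rminus_diag, Rabs_R0, Rmult_0_l in H by reflexivity; lra.
Qed.

Lemma badly_approximable_neq0 (th : R) : badly_approximable th -> th <> 0.
Proof.
intros H E; apply (badly_approximable_neq th 0 1 H); [lia|rewrite E; ring].
Qed.

(** * Reciprocity between the secant and tangent series *)

Definition tan_term (x : R) (k : nat) : R :=
  (-1) ^ k * (tan (odd k * PI * x) / odd k ^ 2).

Section Reciprocity.
Variable th : R.
Hypothesis th_bad : badly_approximable th.

Let th_neq0 : th <> 0 := badly_approximable_neq0 th th_bad.

Let cos_neq0 (n : nat) : cos (PI / 2 * (th * odd n)) <> 0.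
Proof.
apply cos_half_PI_neq0; intros i E; rewrite <- IZR_odd in E; symmetry in E; revert E.
apply badly_approximable_neq; [exact th_bad|lia].
Qed.

Let cos_neq0' (m : nat) : cos (PI / 2 * (odd m / th)) <> 0.
Proof.
apply cos_half_PI_neq0; intros i E.
apply (badly_approximable_neq th (2 * Z.of_nat m + 1) (2 * i + 1) th_bad); [lia|].
rewrite IZR_odd, <- E; field; exact th_neq0.
Qed.

Let a (n m : nat) : R := (-1) ^ m * / (odd m * (odd m ^ 2 - (th * odd n) ^ 2)).

(** With [z = th * odd n], the identity [1 / (m (m^2 - z^2)) = (m / (m^2 - z^2) - 1 / m) / z^2]
    splits a row into a secant expansion minus the Leibniz series. *)
Let a_row (n M : nat) :
  sum_n (a n) M = / (th * odd n) ^ 2 *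
    (sum_n (fun m => (-1) ^ m * (odd m / (odd m ^ 2 - (th * odd n) ^ 2))) M
     - sum_n (fun m => (-1) ^ m / odd m) M) :> R.
Proof.
assert (E : forall m, a n m = / (th * odd n) ^ 2 *
  ((-1) ^ m * (odd m / (odd m ^ 2 - (th * odd n) ^ 2)) - (-1) ^ m / odd m)).
{ intros m; unfold a; pose proof (odd_ge1 n); pose proof (odd_ge1 m).
  pose proof (odd_sqr_minus_neq0 m _ (cos_neq0 n)) as Hq; simpl in Hq.
  pose proof th_neq0; field; repeat split; lra. }
induction M as [|M IH]; rewrite ?sum_n_0, ?sum_n_S, E; [reflexivity|].
rewrite IH; ring.
Qed.

Let a_row_bound (M n : nat) :
  Rabs (sum_n (a n) M) <= 4 * PI / th ^ 2 * / (odd n ^ 2 * Rabs (cos (PI / 2 * (th * odd n)))).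
Proof.
pose proof (odd_ge1 n) as Ho; pose proof PI_RGT_0 as HP.
pose proof (pow2_gt_0 _ th_neq0) as Ht.
pose proof (Rabs_pos_lt _ (cos_neq0 n)) as Hc.
assert (Hc1 : Rabs (cos (PI / 2 * (th * odd n))) <= 1)
  by (apply Rabs_le; pose proof (COS_bound (PI / 2 * (th * odd n))); lra).
pose proof (sec_partial_sum_bound _ M (cos_neq0 n)) as B1.
(* The Leibniz partial sums are the secant partial sums at [y = 0]. *)
assert (B2 : Rabs (sum_n (fun m => (-1) ^ m / odd m) M) <= 2 * PI).
{ assert (C0 : cos (PI / 2 * 0) = 1) by (rewrite Rmult_0_r; apply cos_0).
  pose proof (sec_partial_sum_bound 0 M) as B; rewrite C0, Rabs_R1 in B.
  rewrite (sum_n_ext (fun m => (-1) ^ m / odd m)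
             (fun m => (-1) ^ m * (odd m / (odd m ^ 2 - 0 ^ 2)))).
  - unfold Rdiv in B at 2; rewrite Rinv_1, Rmult_1_r in B; apply B; lra.
  - intros m; pose proof (odd_ge1 m); simpl; field; nra. }
assert (B3 : 2 * PI <= 2 * PI / Rabs (cos (PI / 2 * (th * odd n)))).
{ revert Hc Hc1; generalize (Rabs (cos (PI / 2 * (th * odd n)))); intros x Hc Hc1.
  apply (Rmult_le_reg_r x); [lra|].
  replace (2 * PI / x * x) with (2 * PI) by (field; lra); nra. }
rewrite a_row, Rabs_mult, Rabs_pos_eq.
2:{ left; apply Rinv_0_lt_compat, pow2_gt_0, Rmult_integral_contrapositive_currified;
      [exact th_neq0|lra]. }
replace (4 * PI / th ^ 2 * / (odd n ^ 2 * Rabs (cos (PI / 2 * (th * odd n)))))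
  with (/ (th * odd n) ^ 2 * (4 * PI / Rabs (cos (PI / 2 * (th * odd n)))))
  by (field; repeat split; first [lra|exact th_neq0]).
apply Rmult_le_compat_l.
- left; apply Rinv_0_lt_compat, pow2_gt_0, Rmult_integral_contrapositive_currified;
    [exact th_neq0|lra].
- apply (Rle_trans _ _ _ (Rabs_triang _ (- _))); rewrite Rabs_Ropp.
  replace (4 * PI / Rabs (cos (PI / 2 * (th * odd n))))
    with (2 * PI / Rabs (cos (PI / 2 * (th * odd n)))
          + 2 * PI / Rabs (cos (PI / 2 * (th * odd n)))) by (field; lra).
  lra.
Qed.

Let h (n : nat) : R :=
  / (th * odd n) ^ 2 * (PI / 4 / cos (PI / 2 * (th * odd n)) - PI / 4).

Let a_row_lim (n : nat) : is_lim_seq (fun M => sum_n (a n) M) (h n).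
Proof.
eapply is_lim_seq_ext; [intros M; symmetry; apply a_row|].
apply (is_lim_seq_scal_l _ _ (Finite _)).
apply is_lim_seq_minus'; [exact (sec_partial_fractions _ (cos_neq0 n))|exact leibniz_series].
Qed.

(** Factoring [- th ^ 2] out of the denominator turns a column into the tangent expansion at
    [odd m / th]. *)
Let a_column (m : nat) :
  is_series (fun n => a n m) (- (PI / (4 * th)) * tan_term (/ (2 * th)) m).
Proof.
pose proof (odd_ge1 m) as Ho; pose proof th_neq0 as Ht.
assert (Hz : odd m / th <> 0).
{ apply Rmult_integral_contrapositive_currified; [lra|now apply Rinv_neq_0_compat]. }
pose proof (is_series_scal_l (- ((-1) ^ m / (odd m * th ^ 2))) _ _
              (tan_partial_fractions _ (cos_neq0' m) Hz)) as HS.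
replace (- (PI / (4 * th)) * tan_term (/ (2 * th)) m)
  with (scal (- ((-1) ^ m / (odd m * th ^ 2)))
         (PI / (4 * (odd m / th)) * tan (PI / 2 * (odd m / th)))).
2:{ unfold scal; simpl; unfold mult; simpl; unfold tan_term.
    replace (odd m * PI * / (2 * th)) with (PI / 2 * (odd m / th)) by (field; exact Ht).
    field; split; [lra|exact Ht]. }
revert HS; apply is_series_ext; intros n; unfold scal; simpl; unfold mult; simpl; unfold a.
pose proof (odd_sqr_minus_neq0 n _ (cos_neq0' m)) as Hq.
assert (Hq2 : odd m ^ 2 - (th * odd n) ^ 2 <> 0).
{ replace (odd m ^ 2 - (th * odd n) ^ 2) with (- th ^ 2 * (odd n ^ 2 - (odd m / th) ^ 2))
    by (field; exact Ht).
  apply Rmult_integral_contrapositive_currified; [|exact Hq].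
  apply Ropp_neq_0_compat, pow_nonzero, Ht. }
assert (Eq : odd n * (odd n * 1) - odd m / th * (odd m / th * 1)
             = - (odd m ^ 2 - (th * odd n) ^ 2) / th ^ 2) by (field; exact Ht).
rewrite Eq; simpl in *; field; repeat split; first [exact Ht|lra].
Qed.

Lemma secant_reciprocity : exists T,
  is_series (tan_term (/ (2 * th))) T /\
  f_equals (th / 2) (/ 2 - 4 * th / PI ^ 2 * T).
Proof.
pose proof th_neq0 as Ht; pose proof PI_RGT_0 as HP.
destruct th_bad as [c [Hc Hb]].
destruct (tannery (fun M n => sum_n (a n) M) h
  (fun n => 4 * PI / th ^ 2 * / (odd n ^ 2 * Rabs (cos (PI / 2 * (th * odd n)))))) as [Hh Hl].
- exact a_row_bound.
- exact (ex_series_scal_l (V := R_NormedModule) (4 * PI / th ^ 2) _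
           (secant_summable th c Hc Hb)).
- exact a_row_lim.
(* The first [M + 1] columns add up to the series over [n] of truncated rows, so the limit from
   [tannery] also yields convergence of the tangent series. *)
- assert (Hv : is_series (fun m => - (PI / (4 * th)) * tan_term (/ (2 * th)) m) (Series h)).
  { change (is_lim_seq (sum_n (fun m => - (PI / (4 * th)) * tan_term (/ (2 * th)) m)) (Series h)).
    eapply is_lim_seq_ext; [|exact Hl]; intros M; simpl.
    apply is_series_unique, is_series_sum_n, a_column. }
  exists (- (4 * th / PI) * Series h); split.
  + apply (is_series_scal_l (- (4 * th / PI))) in Hv; revert Hv.
    apply is_series_ext; intros m; unfold scal; simpl; unfold mult; simpl; field.
    split; first [lra|exact Ht].
  (* This factor turns [h n] into the [n]-th secant term minus [4 / (PI ^ 2 * odd n ^ 2)]; adding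
     back the latter contributes the summand one half. *)
  + pose proof (is_series_scal_l (16 * th ^ 2 / PI ^ 3) _ _ (Series_correct _ Hh)) as S1.
    pose proof (is_series_scal_l (4 / PI ^ 2) _ _ sum_inv_odd_sqr) as S2.
    pose proof (is_series_plus _ _ _ _ S1 S2) as S3.
    unfold f_equals.
    replace (/ 2 - 4 * th / PI ^ 2 * (- (4 * th / PI) * Series h))
      with (plus (scal (16 * th ^ 2 / PI ^ 3) (Series h)) (scal (4 / PI ^ 2) (PI ^ 2 / 8))).
    2:{ unfold plus, scal; simpl; unfold mult; simpl; field; lra. }
    revert S3; apply is_series_ext; intros n.
    unfold plus, scal; simpl; unfold mult; simpl; unfold h, f_term.
    fold (odd n); pose proof (odd_ge1 n); pose proof (cos_neq0 n).
    replace (odd n * PI * (th / 2)) with (PI / 2 * (th * odd n)) by field.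
    field; repeat split; first [lra|assumption].
Qed.

End Reciprocity.

(** * Quadratic irrationals *)

(* Descent: a solution [s = m x], [x^2 = N (N + 1)], yields the smaller one
   with [m' = m (x - N)], since [N < x < N + 1]. *)
Lemma consecutive_product_not_square (N m s : Z) : (1 <= N)%Z -> (0 < m)%Z ->
  (0 < s)%Z -> (N * (N + 1) * (m * m) <> s * s)%Z.
Proof.
intros HN Hm; assert (Hm0 : (0 <= m)%Z) by lia; revert s Hm.
apply (Z_lt_induction (fun m => forall s, (0 < m)%Z -> (0 < s)%Z ->
  (N * (N + 1) * (m * m) <> s * s)%Z)); [|exact Hm0].
clear m Hm0; intros m IH s Hm Hs E.
assert (Hm2 : (0 < m * m)%Z) by nia.
assert (H1 : (N * m < s)%Z) by nia.
assert (H2 : (s < (N + 1) * m)%Z) by nia.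
apply (IH (s - N * m)%Z ltac:(nia) (N * (N + 1) * m - N * s)%Z ltac:(lia)).
- nia.
- replace (N * (N + 1) * ((s - N * m) * (s - N * m)))%Z
    with (N * (N + 1) * (s * s) - 2 * N * (N * (N + 1)) * s * m
          + N * N * (N * (N + 1) * (m * m)))%Z by ring.
  replace ((N * (N + 1) * m - N * s) * (N * (N + 1) * m - N * s))%Z
    with (N * (N + 1) * (N * (N + 1) * (m * m)) - 2 * N * (N * (N + 1)) * s * m
          + N * N * (s * s))%Z by ring.
  rewrite E; ring.
Qed.

(** Multiplying a zero of the form by [p] makes the product of the consecutive integers [2pK] and
    [2pK + 1], times a square, equal to [(p * n)^2]. For negative [p] the same product is
    [N * (N + 1)] with [N = - 2pK - 1]. *)
Lemma form_neq0 (K : nat) (p m n : Z) : (0 < K)%nat -> p <> 0%Z -> (m <> 0 \/ n <> 0)%Z ->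
  (2 * Z.of_nat K * (2 * p * Z.of_nat K + 1) * (m * m) - p * (n * n) <> 0)%Z.
Proof.
intros HK Hp Hmn E; set (k := Z.of_nat K) in *.
assert (Hk : (0 < k)%Z) by lia.
assert (Hq : (2 * k * (2 * p * k + 1) <> 0)%Z) by nia.
assert (Hm : m <> 0%Z) by (intros ->; destruct Hmn as [|Hn]; [lia|nia]).
assert (Hn : n <> 0%Z) by (intros ->; nia).
assert (E2 : (2 * p * k * (2 * p * k + 1) * (Z.abs m * Z.abs m)
              = Z.abs (p * n) * Z.abs (p * n))%Z).
{ rewrite !Z.abs_square.
  replace (2 * p * k * (2 * p * k + 1) * (m * m))%Z
    with (p * (2 * k * (2 * p * k + 1) * (m * m)))%Z by ring.
  replace (2 * k * (2 * p * k + 1) * (m * m))%Z with (p * (n * n))%Z by lia; ring. }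
assert (Hpn : (p * n <> 0)%Z) by nia.
destruct (Z_lt_dec 0 p) as [H|H].
- apply (consecutive_product_not_square (2 * p * k) (Z.abs m) (Z.abs (p * n))
           ltac:(nia) ltac:(lia) ltac:(lia)); exact E2.
- apply (consecutive_product_not_square (- (2 * p * k) - 1) (Z.abs m) (Z.abs (p * n))
           ltac:(nia) ltac:(lia) ltac:(lia)).
  rewrite <- E2; ring.
Qed.

(** Liouville's argument: the form is a nonzero integer equal to [q (m - th n) (m + th n)], and the
    conjugate factor is at most [(1 + |th|) (|m| + |n|)]. *)
Lemma quadratic_badly_approximable (th : R) (p q : Z) : IZR q * th ^ 2 = IZR p ->
  (forall m n, (m <> 0 \/ n <> 0)%Z -> (q * (m * m) - p * (n * n) <> 0)%Z) ->
  badly_approximable th.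
Proof.
intros Hth Hform.
assert (Hq : q <> 0%Z) by (intros ->; apply (Hform 1%Z 0%Z); lia).
assert (Hq1 : 1 <= Rabs (IZR q)) by (rewrite <- abs_IZR; apply IZR_le; lia).
pose proof (Rabs_pos th) as Ht.
exists (/ (Rabs (IZR q) * (1 + Rabs th))); split; [apply Rinv_0_lt_compat; nra|].
intros m n Hmn; specialize (Hform m n Hmn).
assert (H1 : 1 <= Rabs (IZR q) * (Rabs (IZR m - th * IZR n) * Rabs (IZR m + th * IZR n))).
{ rewrite <- !Rabs_mult.
  replace (IZR q * ((IZR m - th * IZR n) * (IZR m + th * IZR n)))
    with (IZR (q * (m * m) - p * (n * n)))
    by (rewrite minus_IZR, !mult_IZR, <- Hth; ring).
  rewrite <- abs_IZR; apply IZR_le; lia. }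
assert (H2 : Rabs (IZR m + th * IZR n) <= (1 + Rabs th) * (Rabs (IZR m) + Rabs (IZR n))).
{ apply (Rle_trans _ _ _ (Rabs_triang _ _)); rewrite Rabs_mult.
  pose proof (Rabs_pos (IZR m)); pose proof (Rabs_pos (IZR n)); nra. }
pose proof (Rabs_pos (IZR m - th * IZR n)) as H3.
set (A := Rabs (IZR m - th * IZR n)) in *.
apply (Rmult_le_reg_l (Rabs (IZR q) * (1 + Rabs th))); [nra|].
rewrite Rinv_r by nra; apply (Rle_trans _ _ _ H1).
rewrite (Rmult_assoc (Rabs (IZR q))); apply Rmult_le_compat_l; [lra|].
replace ((1 + Rabs th) * (A * (Rabs (IZR m) + Rabs (IZR n))))
  with (A * ((1 + Rabs th) * (Rabs (IZR m) + Rabs (IZR n)))) by ring.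
now apply Rmult_le_compat_l.
Qed.

Lemma badly_approximable_denominator (th : R) (j : Z) :
  badly_approximable th -> 1 + IZR j * th <> 0.
Proof.
intros Hb E; apply (badly_approximable_neq th 1 (- j) Hb); [lia|].
rewrite opp_IZR; lra.
Qed.

(** The linear form of the image at [(m, n)] is that of [th] at [(m, n - j m)], divided by
    [1 + j th]; this change of lattice point is invertible and alters sizes by a bounded factor. *)
Lemma badly_approximable_moebius (th : R) (j : Z) :
  badly_approximable th -> badly_approximable (th / (1 + IZR j * th)).
Proof.
intros Hb; pose proof (badly_approximable_denominator th j Hb) as Hd.
destruct Hb as [c [Hc H]].
pose proof (Rabs_pos_lt _ Hd) as Hd1; pose proof (Rabs_pos (IZR j)) as Hj.
set (d := 1 + IZR j * th) in *.
exists (c / (Rabs d * (1 + Rabs (IZR j)))); split.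
{ apply Rdiv_lt_0_compat; [lra|apply Rmult_lt_0_compat; lra]. }
intros m n Hmn.
assert (Hmn' : (m <> 0 \/ n - j * m <> 0)%Z) by (destruct (Z.eq_dec m 0) as [->|]; lia).
specialize (H m (n - j * m)%Z Hmn').
replace (IZR m - th / d * IZR n) with ((IZR m - th * IZR (n - j * m)) / d).
2:{ rewrite minus_IZR, mult_IZR.
    replace (IZR m - th * (IZR n - IZR j * IZR m)) with (d * IZR m - th * IZR n)
      by (unfold d; ring).
    field; exact Hd. }
unfold Rdiv at 2; rewrite Rabs_mult, Rabs_inv.
assert (H2 : Rabs (IZR m) + Rabs (IZR (n - j * m))
             <= (1 + Rabs (IZR j)) * (Rabs (IZR m) + Rabs (IZR n))).
{ rewrite minus_IZR, mult_IZR.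
  pose proof (Rabs_triang (IZR n) (- (IZR j * IZR m))) as H3.
  rewrite Rabs_Ropp, Rabs_mult in H3.
  pose proof (Rmult_le_pos _ _ Hj (Rabs_pos (IZR n))); unfold Rminus; lra. }
set (A := Rabs (IZR m - th * IZR (n - j * m))) in *.
assert (HA : 0 <= A) by apply Rabs_pos.
apply (Rmult_le_reg_l (Rabs d * (1 + Rabs (IZR j)))); [apply Rmult_lt_0_compat; lra|].
replace (Rabs d * (1 + Rabs (IZR j)) * (c / (Rabs d * (1 + Rabs (IZR j)))))
  with c by (field; lra).
replace (Rabs d * (1 + Rabs (IZR j)) * (A * / Rabs d * (Rabs (IZR m) + Rabs (IZR n))))
  with (A * ((1 + Rabs (IZR j)) * (Rabs (IZR m) + Rabs (IZR n)))) by (field; lra).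
apply (Rle_trans _ _ _ H); now apply Rmult_le_compat_l.
Qed.

(** * Periodicity and the linear equation for the tangent series *)

Lemma tan_term_shift (x : R) (i : Z) (k : nat) : tan_term (x + IZR i) k = tan_term x k.
Proof.
unfold tan_term, tan.
replace (odd k * PI * (x + IZR i))
  with (odd k * PI * x + IZR ((2 * Z.of_nat k + 1) * i) * PI)
  by (rewrite mult_IZR, IZR_odd; ring).
destruct (trig_shift (odd k * PI * x) ((2 * Z.of_nat k + 1) * i)) as [-> ->].
do 2 f_equal; unfold Rdiv.
destruct (Z.even _); rewrite Rinv_mult, ?Rinv_1.
- ring.
- replace (/ -1) with (-1) by field; ring.
Qed.

Lemma f_term_shift (r : R) (i : Z) (k : nat) :
  f_term (r + IZR i) k = (if Z.even i then 1 else -1) * f_term r k.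
Proof.
unfold f_term; fold (odd k).
replace (odd k * PI * (r + IZR i))
  with (odd k * PI * r + IZR ((2 * Z.of_nat k + 1) * i) * PI)
  by (rewrite mult_IZR, IZR_odd; ring).
destruct (trig_shift (odd k * PI * r) ((2 * Z.of_nat k + 1) * i)) as [-> _].
(* An odd multiple of [i] has the parity of [i], so the sign is the same for all [k]. *)
replace (Z.even ((2 * Z.of_nat k + 1) * i)) with (Z.even i).
2:{ rewrite Z.even_mul, Z.even_add, Z.even_mul; reflexivity. }
rewrite Rinv_mult; destruct (Z.even i); rewrite ?Rinv_1.
- unfold Rdiv; ring.
- replace (/ -1) with (-1) by field; unfold Rdiv; ring.
Qed.

(** The map sends [1 / (2 th)] to [1 / (2 th) + i], so by periodicity reciprocity at the image
    involves the same [T]. *)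
Lemma f_equals_moebius (th T : R) (i : Z) : badly_approximable th ->
  is_series (tan_term (/ (2 * th))) T ->
  f_equals (th / (1 + IZR (2 * i) * th) / 2)
    (/ 2 - 4 * (th / (1 + IZR (2 * i) * th)) / PI ^ 2 * T).
Proof.
intros Hb HT.
destruct (secant_reciprocity _ (badly_approximable_moebius th (2 * i) Hb)) as [T' [HT' Hf]].
replace T with T'; [exact Hf|].
rewrite <- (is_series_unique _ _ HT), <- (is_series_unique _ _ HT').
apply Series_ext; intros k; rewrite <- (tan_term_shift (/ (2 * th)) i).
f_equal; pose proof (badly_approximable_neq0 th Hb).
pose proof (badly_approximable_denominator th (2 * i) Hb) as Hd.
rewrite mult_IZR in *; field; split; assumption.
Qed.

Theorem theorem3p2 (K : nat) (p : Z) (hK : (0 < K)%nat) (hp : p <> 0%Z) :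
  let q : R := IZR (2 * Z.of_nat K * (2 * p * Z.of_nat K + 1)) in
  f_equals (/ 2 * sqrt (IZR p / q))
    (if Z.even p then / 2 else / 2 - INR K / q).
Proof.
intros q.
set (k := IZR (Z.of_nat K)).
assert (Hk : 1 <= k) by (apply IZR_le; lia).
assert (Eq : q = 2 * k * (2 * IZR p * k + 1))
  by (unfold q, k; rewrite !mult_IZR, plus_IZR, !mult_IZR; reflexivity).
assert (Hpq : 0 < IZR p * q).
{ unfold q; rewrite <- mult_IZR; apply IZR_lt.
  destruct (Z_lt_dec 0 p); nia. }
assert (Hp0 : IZR p <> 0) by now apply not_0_IZR.
assert (Hq0 : q <> 0) by (intros E; rewrite E in Hpq; lra).
set (th := sqrt (IZR p / q)).
assert (Hth2 : th ^ 2 = IZR p / q).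
{ apply pow2_sqrt; replace (IZR p / q) with (IZR p * q / q ^ 2) by (field; exact Hq0).
  left; apply Rdiv_lt_0_compat; [exact Hpq|now apply pow2_gt_0]. }
assert (Hb : badly_approximable th).
{ apply (quadratic_badly_approximable th p (2 * Z.of_nat K * (2 * p * Z.of_nat K + 1))).
  - fold q; rewrite Hth2; field; exact Hq0.
  - intros m n; now apply form_neq0. }
pose proof (badly_approximable_neq0 th Hb) as Hth0.
destruct (secant_reciprocity th Hb) as [T [HT Hf]].
pose proof (f_equals_moebius th T (Z.of_nat K) Hb HT) as Hf1.
pose proof (f_equals_moebius th T (- Z.of_nat K) Hb HT) as Hf2.
pose proof (badly_approximable_denominator th (2 * Z.of_nat K) Hb) as Hd1.
pose proof (badly_approximable_denominator th (2 * - Z.of_nat K) Hb) as Hd2.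
rewrite mult_IZR in Hf1, Hf2, Hd1, Hd2; rewrite opp_IZR in Hf2, Hd2; fold k in Hf1, Hf2, Hd1, Hd2.
set (th1 := th / (1 + 2 * k * th)) in *.
set (th2 := th / (1 + 2 * - k * th)) in *.
(* Here the shape of [q] enters: [q - 4 * k ^ 2 * p] collapses to [2 * k], which makes [th2 - th1]
   an even integer. *)
assert (Hprod : (1 + 2 * k * th) * (1 + 2 * - k * th) = 2 * k / q).
{ replace ((1 + 2 * k * th) * (1 + 2 * - k * th)) with (1 - 4 * k ^ 2 * th ^ 2) by ring.
  rewrite Hth2.
  replace (1 - 4 * k ^ 2 * (IZR p / q)) with ((q - 4 * k ^ 2 * IZR p) / q)
    by (field; exact Hq0).
  f_equal; rewrite Eq; ring. }
assert (Hdiff : th2 = th1 + 2 * IZR p).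
{ apply (Rplus_eq_reg_r (- th1)).
  replace (th2 + - th1)
    with (4 * k * th ^ 2 / ((1 + 2 * k * th) * (1 + 2 * - k * th)))
    by (unfold th1, th2; field; split; assumption).
  rewrite Hprod, Hth2; field; split; lra. }
assert (Hsum : th1 + th2 = th * q / k).
{ replace (th1 + th2) with (2 * th / ((1 + 2 * k * th) * (1 + 2 * - k * th)))
    by (unfold th1, th2; field; split; assumption).
  rewrite Hprod; field; split; lra. }
(* The arguments [th1 / 2] and [th2 / 2] differ by the integer [p], so the two values of the secant
   series agree up to the sign [(-1)^p]. *)
assert (Hrel : / 2 - 4 * th2 / PI ^ 2 * T
               = (if Z.even p then 1 else -1) * (/ 2 - 4 * th1 / PI ^ 2 * T)).
{ rewrite <- (is_series_unique _ _ Hf2).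
  apply is_series_unique.
  apply (is_series_scal_l (if Z.even p then 1 else -1)) in Hf1.
  revert Hf1; apply is_series_ext; intros n.
  replace (th2 / 2) with (th1 / 2 + IZR p) by (rewrite Hdiff; field).
  symmetry; apply f_term_shift. }
pose proof PI_RGT_0 as HP.
replace (/ 2 * th) with (th / 2) by field.
revert Hf; unfold f_equals.
match goal with |- is_series _ ?u -> is_series _ ?v => replace u with v; [trivial|] end.
destruct (Z.even p).
(* For even [p] the two values coincide, hence [(th2 - th1) * T = 0] and [T] vanishes. *)
- assert (HT0 : IZR p * (8 / PI ^ 2) * T = 0).
  { rewrite Hdiff in Hrel; unfold Rdiv in *; lra. }
  apply Rmult_integral in HT0; destruct HT0 as [HT0| ->]; [exfalso|ring].
  apply Rmult_integral in HT0; destruct HT0 as [HT0|HT0]; [now apply Hp0|].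
  assert (0 < 8 / PI ^ 2) by (apply Rdiv_lt_0_compat; [lra|apply pow_lt; lra]); lra.
(* For odd [p] the two values add up to 0; with [th1 + th2 = th * q / k] this says that the
   correction [4 * th / PI ^ 2 * T] equals [k / q]. *)
- assert (E1 : 4 / PI ^ 2 * T * (th1 + th2) = 1) by (unfold Rdiv in *; lra).
  rewrite Hsum in E1.
  rewrite INR_IZR_INZ; fold k; apply (f_equal (fun z => / 2 - z)).
  apply (Rmult_eq_reg_r (q / k)).
  2:{ apply Rmult_integral_contrapositive_currified; [exact Hq0|apply Rinv_neq_0_compat; lra]. }
  replace (k / q * (q / k)) with 1 by (field; split; [lra|exact Hq0]).
  rewrite <- E1; field; split; lra.
Qed.
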